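(* Let $V$ be a finite dimensional real inner product space and let $\mu$ be a Borel probability measure on $V$. Then there exists $h'\in V$ such that for every symmetry $S\in\mathbb{A}(\mu)$ \[ \mu*\delta(h') = S(\mu*\delta(h')). \]
   Context: For a linear operator $S$ on $V$ and a probability measure $\mu$ on $V$, $S\mu$ denotes the image measure $S\mu(E)=\mu(S^{-1}(E))$; $*$ between measures denotes convolution; $\delta(h)$ is the point mass at $h$. A linear operator $S\in\operatorname{End}V$ (not assumed invertible) is a symmetry of $\mu$ if there is an $h\in V$ with $\mu=S\mu*\delta(h)$; $\mathbb{A}(\mu)$ denotes the set of all symmetries of $\mu$. *)

(* Defs.v *)
From HB Require Import structures.
From mathcomp Require Import all_boot all_order all_algebra.
From mathcomp Require Import all_classical all_reals all_analysis.
From mathcomp Require Import sesquilinear ring lra.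

Set Implicit Arguments.
Unset Strict Implicit.
Unset Printing Implicit Defensive.

Import Order.TTheory GRing.Theory Num.Theory.
Import numFieldNormedType.Exports.

Local Open Scope classical_set_scope.
Local Open Scope ring_scope.

(* A [vectType] is finite dimensional, and [{dot V for idfun}] is the type of
   positive definite symmetric bilinear forms on [V]. This alias of [V] carries
   the norm, the topology and the Borel sigma-algebra induced by [ip]. *)
Definition inner_space (R : realType) (V : vectType R) (ip : {dot V for idfun})
  : Type := V.

Section inner_space_theory.
Variables (R : realType) (V : vectType R) (ip : {dot V for idfun}).

Definition inner_norm (x : V) : R := Num.sqrt (ip x x).

Let ipC x y : ip x y = ip y x.
Proof. by rewrite [LHS]hermitian_subproof expr0 mul1r. Qed.

Let ipDl x y z : ip (x + y) z = ip x z + ip y z.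
Proof. exact: linearDl. Qed.

Let ipDr x y z : ip x (y + z) = ip x y + ip x z.
Proof. by rewrite ipC ipDl !(ipC x). Qed.

Let ipZl a x y : ip (a *: x) y = a * ip x y.
Proof. exact: linearZl_LR. Qed.

Let ipZr a x y : ip x (a *: y) = a * ip x y.
Proof. by rewrite ipC ipZl (ipC x). Qed.

Let ip0 : ip 0 0 = 0.
Proof. by rewrite -(scale0r (0 : V)) ipZl mul0r. Qed.

Let ip_ge0 x : 0 <= ip x x.
Proof. by have [->|/neq0_dnorm_gt0/ltW//] := eqVneq x 0; rewrite ip0. Qed.

Let CS x y : ip x y ^+ 2 <= ip x x * ip y y.
Proof.
have [->|x0] := eqVneq x 0.
  by rewrite -(scale0r (0 : V)) !ipZl !mul0r expr0n.
have xx0 : 0 < ip x x by exact: neq0_dnorm_gt0.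
have := ip_ge0 (ip x x *: y + (- ip x y) *: x).
rewrite !(ipDl, ipDr, ipZl, ipZr) (ipC y x) => h.
have {}h : 0 <= ip x x * (ip x x * ip y y - ip x y ^+ 2).
  by apply: le_trans h _; lra.
by move: h; rewrite pmulr_rge0// subr_ge0.
Qed.

Lemma inner_norm_triangle x y : inner_norm (x + y) <= inner_norm x + inner_norm y.
Proof.
rewrite -(@ler_pXn2r _ 2) ?nnegrE ?addr_ge0 ?sqrtr_ge0//.
rewrite sqrrD !sqr_sqrtr// ipDl !ipDr (ipC y x).
suff: ip x y <= inner_norm x * inner_norm y by rewrite mulr2n => ?; lra.
rewrite /inner_norm -sqrtrM// (le_trans (ler_norm _))// -sqrtr_sqr.
by rewrite ler_wsqrtr.
Qed.

Lemma inner_norm_eq0 x : inner_norm x = 0 -> x = 0.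
Proof.
move=> /eqP; rewrite sqrtr_eq0; apply: contraTeq => x0.
by rewrite -ltNge neq0_dnorm_gt0.
Qed.

Lemma inner_normZ a x : inner_norm (a *: x) = `|a| * inner_norm x.
Proof.
by rewrite /inner_norm ipZl ipZr mulrA -expr2 sqrtrM ?sqr_ge0// sqrtr_sqr.
Qed.

Lemma inner_normMn x n : inner_norm (x *+ n) = inner_norm x *+ n.
Proof. by rewrite -scaler_nat inner_normZ normr_nat mulr_natl. Qed.

Lemma inner_normN x : inner_norm (- x) = inner_norm x.
Proof. by rewrite -scaleN1r inner_normZ normrN1 mul1r. Qed.

Local Notation E := (inner_space ip).

HB.instance Definition _ := Vector.on E.
HB.instance Definition _ := isPointed.Build E 0.
HB.instance Definition _ := Num.Zmodule_isNormed.Build R E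
  inner_norm_triangle inner_norm_eq0 inner_normMn inner_normN.

Let inner_dist (x y : E) : R := `|y - x|.

Let inner_distxx x : inner_dist x x = 0.
Proof. by rewrite /inner_dist subrr normr0. Qed.

Let inner_dist_eq0 x y : inner_dist x y = 0 -> x = y.
Proof. by move=> /normr0_eq0/eqP; rewrite subr_eq0 => /eqP. Qed.

Let inner_distC x y : inner_dist x y = inner_dist y x.
Proof. exact: distrC. Qed.

Let inner_dist_triangle y x z :
  inner_dist x z <= inner_dist x y + inner_dist y z.
Proof. by rewrite addrC; exact: ler_distD. Qed.

HB.instance Definition _ := isMetric.Build R E
  inner_distxx inner_dist_eq0 inner_distC inner_dist_triangle.

Let mdist_inner_norm (x y : E) : mdist x y = `|y - x|.
Proof. by []. Qed.

HB.instance Definition _ := NormedZmoduleMetric.Build R E mdist_inner_norm.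
HB.instance Definition _ :=
  PseudoMetricNormedZmod_Lmodule_isNormedModule.Build R E inner_normZ.

HB.instance Definition _ := Measurable.copy E (g_sigma_algebraType (@open E)).

End inner_space_theory.

Section symmetries.
Variables (R : realType) (V : vectType R) (ip : {dot V for idfun}).
Local Notation E := (inner_space ip).
Implicit Types (mu nu : set E -> \bar R) (S : 'End(E)).

(* Measures are total functions on subsets, so they are compared only on the
   measurable ones. *)
Definition measure_eq mu nu := forall A, measurable A -> mu A = nu A.

Definition image_measure S mu : set E -> \bar R := pushforward mu (S : E -> E).

Definition convolution mu nu : set E -> \bar R :=
  pushforward (mu \x nu)%E (fun z : E * E => z.1 + z.2).

Definition symmetries mu : set 'End(E) :=
  [set S | exists h : E,
     measure_eq mu (convolution (image_measure S mu) (\d_h))].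

End symmetries.

(* Main.v *)
Require Import Defs.
From HB Require Import structures.
From mathcomp Require Import all_boot all_order all_algebra.
From mathcomp Require Import all_classical all_reals all_analysis.
From mathcomp Require Import sesquilinear measurable_realfun lra.

Set Implicit Arguments.
Unset Strict Implicit.
Unset Printing Implicit Defensive.

Import Order.TTheory GRing.Theory Num.Theory.
Import numFieldNormedType.Exports.

Local Open Scope classical_set_scope.
Local Open Scope ring_scope.

(** A symmetry [S] with translation [h] amounts to an affine map
    [T x = S x + h] that preserves [mu], and it suffices to find a common
    fixed point [b] of all these maps: [h' = - b] then works. For [a > 0] and
    [C] let [B] be the set of the points [x] such that [|f x| <= C] for every
    affine function [f] with [mu {|f| > 1} < a]. Since [B] is defined from
    [mu] and the affine structure only, it is contained in its preimage under
    [T], hence equal to it up to a null set. Moreover [B] is closed and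
    bounded, so if [mu B > 0] the barycenter of [mu] restricted to [B] is
    fixed by every [T].

    That [mu B > 0] for suitable [a] and [C] rests on the equivalence of the
    sup and [L^2(mu)] norms on a finite dimensional space of bounded
    functions. It is applied to the functions [f w], with [f] affine and
    [w x = 1 / (1 + |x|)]: if [(f w)^2 <= K Q] almost everywhere, where [Q] is
    the integral of [(f w)^2], then [Q <= 1 + K Q mu {|f| > 1}], which bounds
    [Q] as soon as [K a <= 1/2]. *)

(** * Gram-Schmidt for semidefinite forms *)

Section gram_schmidt.
Variables (R : rcfType) (L : lmodType R) (P : L -> Prop) (B : L -> L -> R).
Hypothesis P0 : P 0.
Hypothesis Plin : forall a x y, P x -> P y -> P (a *: x + y).
Hypothesis BC : forall x y, B x y = B y x.
Hypothesis Blin : forall a x y z, P x -> P y -> P z ->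
  B (a *: x + y) z = a * B x z + B y z.
Hypothesis B_ge0 : forall x, 0 <= B x x.

Let PZ a x : P x -> P (a *: x).
Proof. by move=> Px; rewrite -[_ *: _]addr0; exact: Plin. Qed.

Let PB x y : P x -> P y -> P (x - y).
Proof. by move=> Px Py; rewrite addrC -scaleN1r; exact: Plin. Qed.

Let B0 z : P z -> B 0 z = 0.
Proof.
move=> Pz; have := Blin 1 P0 P0 Pz; rewrite scaler0 addr0 mul1r => /eqP.
by rewrite -subr_eq0 opprD addrA subrr add0r oppr_eq0 => /eqP.
Qed.

Let BZ a x z : P x -> P z -> B (a *: x) z = a * B x z.
Proof. by move=> Px Pz; rewrite -[a *: x]addr0 Blin// B0// addr0. Qed.

Let BB x y z : P x -> P y -> P z -> B (x - y) z = B x z - B y z.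
Proof.
by move=> Px Py Pz; rewrite addrC -scaleN1r Blin// mulN1r addrC.
Qed.

(** Linearity of [B] is only available inside the subspace [P], because the intended [B] is an
    integral of products, additive only on suitably integrable functions. Membership in [P] is
    therefore carried through the induction together with the formula. *)
Lemma form_sum n (c : 'I_n -> R) (x : 'I_n -> L) : (forall i, P (x i)) ->
  P (\sum_i c i *: x i) /\
  forall z, P z -> B (\sum_i c i *: x i) z = \sum_i c i * B (x i) z.
Proof.
move=> Px; have : forall s : seq 'I_n, P (\sum_(i <- s) c i *: x i) /\
  forall z, P z ->
    B (\sum_(i <- s) c i *: x i) z = \sum_(i <- s) c i * B (x i) z.
  elim=> [|i s [Ps IH]].
    by split=> [|z Pz]; rewrite !big_nil//; exact: B0.
  split=> [|z Pz]; rewrite !big_cons; first exact: Plin.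
  by rewrite Blin// IH.
exact.
Qed.

(* [B] is only semidefinite (it vanishes on functions that are null almost
   everywhere), so the remainder is [B]-isotropic rather than zero. *)
Lemma gram_schmidt (G : seq L) : (forall g, g \in G -> P g) ->
  exists k (e : 'I_k -> L), [/\ forall i, P (e i),
    forall i j, B (e i) (e j) = (i == j)%:R &
    forall g, g \in G -> exists a : 'I_k -> R,
      let r := g - \sum_i a i *: e i in B r r = 0].
Proof.
elim: G => [_|g G IH PG]; first by exists 0%N, (fun=> 0); split=> // -[].
have [|k [e [Pe ee Ge]]] := IH.
  by move=> h hG; apply: PG; rewrite inE hG orbT.
have Pg : P g by apply: PG; rewrite inE eqxx.
pose a i := B g (e i); have [Ps Bs] := form_sum a Pe.
set s := \sum_i _ in Ps Bs; set r := g - s.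
have Pr : P r by exact: PB.
have re i : B r (e i) = 0.
  rewrite BB// Bs// (bigD1 i)//= ee eqxx mulr1 big1 ?addr0 ?subrr// => j ji.
  by rewrite ee (negbTE ji) mulr0.
have [r0|r0] := eqVneq (B r r) 0.
  by exists k, e; split=> // h; rewrite inE => /predU1P[->|/Ge//]; exists a.
have rr_gt0 : 0 < B r r by rewrite lt_neqAle eq_sym r0 B_ge0.
pose n := Num.sqrt (B r r); have n0 : n != 0 by rewrite gt_eqF// sqrtr_gt0.
(* The normalized remainder takes index 0 and the old family is shifted by one. *)
pose e' i := if unlift ord0 i is Some j then e j else n^-1 *: r.
exists k.+1, e'; split=> [i|i j|h].
- by rewrite /e'; case: unliftP => //= *; exact: PZ.
- rewrite /e'; case: unliftP => [i' ->|->]; case: unliftP => [j' ->|->].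
  + by rewrite ee (inj_eq lift_inj).
  + by rewrite BC BZ// re mulr0.
  + by rewrite BZ// re mulr0.
  + rewrite BZ ?[B r _]BC ?BZ//; last exact: PZ.
    by rewrite mulrA -invfM -expr2 sqr_sqrtr ?B_ge0// mulVf// eqxx.
- rewrite inE => /predU1P[->|/Ge[b /= hb]].
    exists (fun i => if unlift ord0 i is Some j then a j else n) => /=.
    rewrite big_ord_recl /e' unlift_none scalerA divff// scale1r.
    under eq_bigr do rewrite liftK.
    by rewrite -/s /r subrK subrr B0.
  exists (fun i => if unlift ord0 i is Some j then b j else 0) => /=.
  rewrite big_ord_recl /e' unlift_none scale0r add0r.
  by under eq_bigr do rewrite liftK.
Qed.

End gram_schmidt.

(** * Orthonormal coordinates and Borel measurability in an inner product space *)

Section inner_space_facts.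
Variables (R : realType) (V : vectType R) (ip : {dot V for idfun}).
Local Notation E := (inner_space ip).
Implicit Types x y z : E.

Lemma inner_normE x : `|x| = Num.sqrt (ip x x). Proof. by []. Qed.

Lemma ip_sym x y : ip x y = ip y x.
Proof. by rewrite [LHS]hermitian_subproof expr0 mul1r. Qed.

Lemma ip_linear a x y z : ip (a *: x + y) z = a * ip x z + ip y z.
Proof. by rewrite linearDl/= linearZl_LR. Qed.

Lemma ip_ge0 x : 0 <= ip x x.
Proof.
have [->|/neq0_dnorm_gt0/ltW//] := eqVneq x 0.
by have := ip_linear (-1) 0 0 0; rewrite scaler0 addr0 mulN1r addNr => ->.
Qed.

Lemma ip_eq0 x : ip x x = 0 -> x = 0.
Proof.
move=> x0; apply/eqP; apply: contra_eqT x0 => /neq0_dnorm_gt0 x0.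
by rewrite gt_eqF.
Qed.

(** Gram-Schmidt is run on a vector basis; as [ip] is definite, the isotropic remainders are zero
    and the orthonormal family spans. *)
Lemma orthonormal_basis : exists k (e : 'I_k -> E),
  (forall i j, ip (e i) (e j) = (i == j)%:R) /\
  forall x, x = \sum_i ip x (e i) *: e i.
Proof.
have [k [e [_ ee Ge]]] := @gram_schmidt R E (fun=> True) (fun x y => ip x y) I
  (fun _ _ _ _ _ => I) ip_sym (fun a x y z _ _ _ => ip_linear a x y z) ip_ge0
  (vbasis {:V}) (fun _ _ => I).
exists k, e; split=> // x.
have spanned y : exists a : 'I_k -> R, y = \sum_i a i *: e i.
  have /choice[a ha] : forall j, exists a : 'I_k -> R,
      (vbasis {:V})`_j = \sum_i a i *: e i.
    (* Here [j] is any natural number; past the end of the basis [nth] returns its default 0, and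
       zero coefficients do. *)
    move=> j; have [jb|jb] := ltnP j (size (vbasis {:V})); last first.
      exists (fun=> 0); rewrite nth_default// big1// => i _.
      by rewrite scale0r.
    have [a /= /ip_eq0/eqP] := Ge _ (mem_nth 0 jb).
    by rewrite subr_eq0 => /eqP ->; exists a.
  exists (fun i => \sum_j coord (vbasis {:V}) j y * a j i).
  rewrite [LHS](coord_vbasis (memvf (y : V))).
  under eq_bigr => j _ do rewrite ha scaler_sumr.
  rewrite exchange_big/=; apply: eq_bigr => i _.
  by rewrite scaler_suml; apply: eq_bigr => j _; rewrite scalerA.
have [a xE] := spanned x.
rewrite [LHS]xE; apply: eq_bigr => i _; congr (_ *: _).
have [_ h] := @form_sum R E (fun=> True) (fun x y => ip x y) I
  (fun _ _ _ _ _ => I) (fun a x y z _ _ _ => ip_linear a x y z) k a e (fun=> I).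
rewrite [in RHS]xE h// (bigD1 i)//= ee eqxx mulr1 big1 ?addr0// => j ji.
by rewrite ee (negbTE ji) mulr0.
Qed.

Section basis.
Variables (k : nat) (e : 'I_k -> E).
Hypothesis eE : forall x, x = \sum_i ip x (e i) *: e i.

Lemma parseval x : `|x| ^+ 2 = \sum_i ip x (e i) ^+ 2.
Proof.
rewrite inner_normE sqr_sqrtr ?ip_ge0//.
have [_ h] := @form_sum R E (fun=> True) (fun x y => ip x y) I
  (fun _ _ _ _ _ => I) (fun a x y z _ _ _ => ip_linear a x y z) k
  (fun i => ip x (e i)) e (fun=> I).
rewrite {1}[x in ip x]eE h//; apply: eq_bigr => i _.
by rewrite expr2 [ip (e i) x]ip_sym.
Qed.

Lemma ip_le_norm x i : `|ip x (e i)| <= `|x|.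
Proof.
rewrite -(@ler_pXn2r _ 2) ?nnegrE// real_normK ?num_real// parseval.
rewrite (bigD1 i)//=.
by rewrite lerDl sumr_ge0// => j _; exact: sqr_ge0.
Qed.

Lemma linear_norm_le (W : normedModType R) (g : {linear E -> W}) x :
  `|g x| <= `|x| * \sum_i `|g (e i)|.
Proof.
rewrite {1}[x]eE linear_sum mulr_sumr; apply: le_trans (ler_norm_sum _ _ _) _.
by apply: ler_sum => i _; rewrite linearZ normrZ ler_wpM2r// ip_le_norm.
Qed.
End basis.

Lemma lipschitz_continuous (W : normedModType R) (g : E -> W) M :
  (forall x y, `|g x - g y| <= `|x - y| * M) -> continuous g.
Proof.
move=> gM x; apply/(@cvgrPdist_lt _ _ _ (nbhs x)) => eps eps0; near=> y.
apply: le_lt_trans (gM _ _) _.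
(* No sign is assumed on [M], so a positive constant above it is used as divisor. *)
have M0 : 0 < `|M| + 1 by rewrite ltr_pwDr.
apply: (@le_lt_trans _ _ (`|x - y| * (`|M| + 1))).
  by rewrite ler_wpM2l// (le_trans (ler_norm _))// lerDl.
rewrite -ltr_pdivlMr//; near: y.
by apply: cvgr_dist_lt => //; rewrite divr_gt0.
Unshelve. all: by end_near. Qed.

Lemma open_measurable_inner (A : set E) : open A -> measurable A.
Proof. exact: sub_sigma_algebra. Qed.

Lemma closed_measurable_inner (A : set E) : closed A -> measurable A.
Proof.
move=> cA; rewrite -[A]setCK; apply: measurableC.
by apply: open_measurable_inner; exact: closed_openC.
Qed.

Lemma continuous_measurable_inner (g : E -> E) :
  continuous g -> measurable_fun setT g.
Proof.
move=> /continuousP cg.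
apply: (@measurability _ _ _ _ _ _ (@open E)) => // _ [A oA <-].
by rewrite setTI; apply: open_measurable_inner; exact: cg.
Qed.

(** In finite dimension a linear map is Lipschitz, with constant the sum of the norms of the images
    of an orthonormal basis; hence continuous and Borel. *)
Lemma measurable_End_affine (S : 'End(E)) (h : E) :
  measurable_fun setT (fun x : E => S x + h).
Proof.
apply: continuous_measurable_inner.
have [k [e [_ eE]]] := orthonormal_basis.
apply: (@lipschitz_continuous E _ (\sum_i `|S (e i)|)) => x y.
rewrite opprD addrACA subrr addr0 -linearB.
exact: (@linear_norm_le _ _ eE E S (x - y)).
Qed.

Lemma measurable_End (S : 'End(E)) : measurable_fun setT (S : E -> E).
Proof.
have := measurable_End_affine S 0; congr measurable_fun.
by apply/funext => x; rewrite addr0.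
Qed.

Lemma measurable_translate (h : E) A :
  measurable A -> measurable [set x : E | A (x + h)].
Proof.
move=> mA; have := measurable_End_affine \1%VF h.
move=> /(_ measurableT A mA); rewrite setTI; congr measurable.
by apply/funext => x /=; rewrite id_lfunE.
Qed.

Lemma continuous_measurable_real (g : E -> R) :
  continuous g -> measurable_fun setT g.
Proof.
move=> /continuousP cg; apply: (measurability _ (RGenOpens.measurableE R)).
move=> _ [_ [a [b ->] <-]]; rewrite setTI.
by apply: open_measurable_inner; apply: cg; exact: interval_open.
Qed.

End inner_space_facts.

(** * Bounded measurable functions on a probability space *)

Section bounded_measurable.
Context d (T : measurableType d) (R : realType) (mu : probability T R).
Implicit Types f g : T -> R.

(** This class is stable under linear combinations and products, and all its members are integrable,
    so the [L^2] form makes sense on it. *)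
Definition bounded_measurable f :=
  measurable_fun setT f /\ exists M, forall x, `|f x| <= M.

Lemma bounded_measurable_integrable f (D : set T) : measurable D ->
  bounded_measurable f -> mu.-integrable D (EFin \o f).
Proof.
move=> mD [mf [M fM]]; apply: measurable_bounded_integrable => //.
- by rewrite (le_lt_trans (probability_le1 _ _))// ltry.
- exact: measurable_funTS.
- exists M; split=> [|N MN x _ /=]; first exact: num_real.
  exact: le_trans (fM x) (ltW MN).
Qed.

Lemma bounded_measurable_lin a f g : bounded_measurable f ->
  bounded_measurable g -> bounded_measurable (fun x => a * f x + g x).
Proof.
move=> [mf [M fM]] [mg [N gN]]; split.
  by apply: measurable_funD => //; exact: measurable_funM.
exists (`|a| * M + N) => x; rewrite (le_trans (ler_normD _ _))// lerD//.
by rewrite normrM ler_wpM2l.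
Qed.

Lemma bounded_measurableM f g : bounded_measurable f ->
  bounded_measurable g -> bounded_measurable (fun x => f x * g x).
Proof.
move=> [mf [M fM]] [mg [N gN]]; split; first exact: measurable_funM.
by exists (M * N) => x; rewrite normrM ler_pM.
Qed.

Lemma bounded_measurable_cst a : bounded_measurable (fun=> a).
Proof. by split=> //; exists `|a|. Qed.

Lemma bounded_measurable_sum n (c : 'I_n -> R) (g : 'I_n -> T -> R) :
  (forall i, bounded_measurable (g i)) ->
  bounded_measurable (fun x => \sum_i c i * g i x).
Proof.
move=> bg; elim: (index_enum _) => [|i s bs].
  by under eq_fun do rewrite big_nil; exact: bounded_measurable_cst.
by under eq_fun do rewrite big_cons; exact: bounded_measurable_lin.
Qed.

Lemma bounded_measurable_comp f (phi : T -> T) : measurable_fun setT phi ->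
  bounded_measurable f -> bounded_measurable (fun x => f (phi x)).
Proof.
move=> mphi [mf [M fM]]; split; first exact: (measurableT_comp mf mphi).
by exists M => x; exact: fM.
Qed.

Lemma Rintegral_sqr_eq0 f : bounded_measurable f ->
  \int[mu]_x (f x * f x) = 0 -> {ae mu, forall x, f x = 0}.
Proof.
move=> bf f0; have bff := bounded_measurableM bf bf.
have iff0 : (\int[mu]_x `|(f x * f x)%:E| = 0)%E.
  transitivity (\int[mu]_x (f x * f x)%:E)%E.
    by apply: eq_integral => x _; rewrite /= ger0_norm// -expr2 sqr_ge0.
  rewrite -[LHS]fineK; last first.
    exact: integrable_fin_num (bounded_measurable_integrable measurableT bff).
  by move: f0; rewrite /Rintegral => ->.
have /ae_eq_integral_abs : measurable_fun setT (fun x => (f x * f x)%:E).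
  by apply/measurable_EFinP; case: bff.
move=> /(_ mu measurableT)[/(_ iff0) + _]; apply: filterS => x /(_ I)[] /eqP.
by rewrite -expr2 sqrf_eq0 => /eqP.
Qed.

Lemma ae_eq_Rintegral f g : bounded_measurable f -> bounded_measurable g ->
  {ae mu, forall x, f x = g x} -> \int[mu]_x f x = \int[mu]_x g x.
Proof.
move=> [mf _] [mg _] fg; congr fine; apply: ae_eq_integral => //.
- exact/measurable_EFinP.
- exact/measurable_EFinP.
- by apply: filterS fg => x -> _.
Qed.

(** Expand in a family that is orthonormal for the [L^2(mu)] form and consists of bounded functions:
    each coefficient is at most the [L^2] norm, so the sum is at most this norm times the sum of the
    bounds. The null set does not depend on [c], since only the finitely many [g j] have to be
    expanded. *)
Lemma ae_sqr_le_Rintegral n (g : 'I_n -> T -> R) :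
  (forall j, bounded_measurable (g j)) -> exists2 K, 0 < K &
  {ae mu, forall x, forall c : 'I_n -> R,
    (\sum_j c j * g j x) ^+ 2 <= K * \int[mu]_y (\sum_j c j * g j y) ^+ 2}.
Proof.
move=> bg; pose L : lmodType R := (T -> R^o).
pose B (p q : L) := \int[mu]_x (p x * q x).
have B0 : bounded_measurable (0 : L) by exact: bounded_measurable_cst.
have Blin a (p q : L) : bounded_measurable p -> bounded_measurable q ->
  bounded_measurable (a *: p + q) by exact: bounded_measurable_lin.
have BC (p q : L) : B p q = B q p.
  by apply: eq_Rintegral => x _; rewrite mulrC.
have BL a (p q r : L) : bounded_measurable p -> bounded_measurable q ->
    bounded_measurable r -> B (a *: p + q) r = a * B p r + B q r.
  move=> bp bq br; rewrite /B -RintegralZl//; last first.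
    exact/bounded_measurable_integrable/bounded_measurableM.
  rewrite -RintegralD//.
  - by apply: eq_Rintegral => x _; rewrite mulrA -mulrDl.
  - apply: bounded_measurable_integrable => //.
    exact/bounded_measurableM/bounded_measurableM/br/bp/bounded_measurable_cst.
  - exact/bounded_measurable_integrable/bounded_measurableM.
have B_ge0 (p : L) : 0 <= B p p.
  by apply: Rintegral_ge0 => x _; rewrite -expr2 sqr_ge0.
have [j|k [e [be ee ge]]] := gram_schmidt B0 Blin BC BL B_ge0 (G := codom g).
  by move=> /codomP[i ->].
(* An isotropic remainder has a square of integral zero, so it vanishes almost everywhere. *)
have {}/choice[a ga] : forall j, exists a : 'I_k -> R,
    {ae mu, forall x, g j x = \sum_i a i * e i x}.
  move=> j; have [a r0] := ge _ (codom_f g j); exists a.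
  have : bounded_measurable (g j - \sum_i a i *: e i : L).
    have [bs _] := form_sum B0 Blin BL a be.
    by rewrite addrC -scaleN1r; exact: Blin.
  move=> /Rintegral_sqr_eq0/(_ r0); apply: filterS => x /eqP.
  by rewrite /= subr_eq0 fct_sumE => /eqP.
have {}ga : {ae mu, forall x, forall c : 'I_n -> R,
    \sum_j c j * g j x = \sum_i (\sum_j c j * a j i) * e i x}.
  have : {ae mu, forall x, forall j, g j x = \sum_i a j i * e i x}.
    exact: filter_forall.
  apply: filterS => x gx c.
  under eq_bigr do rewrite gx mulr_sumr.
  rewrite exchange_big; apply: eq_bigr => i _.
  by rewrite mulr_suml; apply: eq_bigr => j _; rewrite mulrA.
have /choice[M eM] : forall i, exists M, forall x, `|e i x| <= M.
  by move=> i; have [_ [M]] := be i; exists M.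
have M_ge0 : 0 <= \sum_i M i.
  by apply: sumr_ge0 => i _; exact: le_trans (eM i point).
pose b (c : 'I_n -> R) i := \sum_j c j * a j i.
(* Pythagoras, with [b c] the coefficients in the orthonormal family. *)
have intE c : \int[mu]_y (\sum_j c j * g j y) ^+ 2 = \sum_i b c i ^+ 2.
  have [bs Bs] := form_sum B0 Blin BL (b c) be.
  have bgs := bounded_measurable_sum c bg.
  transitivity (B (\sum_i b c i *: e i) (\sum_i b c i *: e i)).
    apply: ae_eq_Rintegral.
    - exact: bounded_measurableM.
    - exact: bounded_measurableM.
    - by apply: filterS ga => x ->; rewrite expr2 !fct_sumE.
  rewrite Bs//; apply: eq_bigr => i _; rewrite BC Bs// (bigD1 i)//= ee eqxx.
  by rewrite mulr1 big1 ?addr0// => j ji; rewrite ee (negbTE ji) mulr0.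
(* Adding 1 keeps the constant positive even if the family [e] is empty. *)
exists ((\sum_i M i + 1) ^+ 2); first by rewrite exprn_gt0// ltr_wpDl.
apply: filterS ga => x gx c; rewrite gx intE -/(b c).
set s := \sum_i b c i ^+ 2; have s_ge0 : 0 <= s.
  by apply: sumr_ge0 => i _; exact: sqr_ge0.
rewrite -[s in leRHS]sqr_sqrtr// -exprMn -real_normK ?num_real//.
rewrite ler_pXn2r ?nnegrE ?mulr_ge0 ?sqrtr_ge0 ?addr_ge0//.
rewrite (le_trans (ler_norm_sum _ _ _))//.
apply: (@le_trans _ _ ((\sum_i M i) * Num.sqrt s)); last first.
  by rewrite ler_wpM2r ?sqrtr_ge0// lerDl.
rewrite mulr_suml; apply: ler_sum => i _; rewrite normrM mulrC ler_pM//.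
rewrite -sqrtr_sqr ler_wsqrtr// /s (bigD1 i)//= lerDl sumr_ge0// => j _.
exact: sqr_ge0.
Qed.
Lemma bounded_measurable_indic (A : set T) : measurable A ->
  bounded_measurable (\1_A : T -> R).
Proof.
move=> mA; split; first exact: measurable_indic.
exists 1 => x; rewrite indicE.
by case: (x \in A); rewrite /= ?normr0 ?normr1.
Qed.

Lemma ae_le_Rintegral f g : bounded_measurable f -> bounded_measurable g ->
  {ae mu, forall x, f x <= g x} -> \int[mu]_x f x <= \int[mu]_x g x.
Proof.
(* The minimum of [f] and [g] has the same integral as [f] and lies below [g] everywhere, not just
   almost everywhere. *)
move=> bf bg fg; have bfg : bounded_measurable (fun x => Num.min (f x) (g x)).
  have [[mf [M fM]] [mg [N gN]]] := (bf, bg).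
  split; first exact: measurable_minr.
  exists (Num.max M N) => x; rewrite /Num.min le_max.
  by case: ifP => _; rewrite ?fM ?gN ?orbT.
rewrite (ae_eq_Rintegral bf bfg); last first.
  by apply: filterS fg => x fgx; rewrite min_l.
apply: le_Rintegral => // [||x _]; try exact: bounded_measurable_integrable.
by rewrite ge_min lexx orbT.
Qed.

Lemma Rintegral_indic (A : set T) : measurable A ->
  \int[mu]_x (\1_A x) = fine (mu A).
Proof. by move=> mA; rewrite /Rintegral integral_indic// setIT. Qed.

Lemma Rintegral_probability_cst (r : R) : \int[mu]_x r = r.
Proof. by rewrite Rintegral_cst//= probability_setT mulr1. Qed.

Lemma fin_num_probability (A : set T) : measurable A -> mu A \is a fin_num.
Proof.
by move=> mA; rewrite ge0_fin_numE// (le_lt_trans (probability_le1 _ _))// ltry.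
Qed.

Lemma Rintegral_invariant (phi : T -> T) (g : T -> R) :
  measurable_fun setT phi ->
  (forall A, measurable A -> mu A = mu (phi @^-1` A)) ->
  bounded_measurable g -> \int[mu]_x g (phi x) = \int[mu]_x g x.
Proof.
move=> mphi muphi bg; congr fine.
have bgphi := bounded_measurable_comp mphi bg.
transitivity (\int[pushforward mu phi]_x (g x)%:E)%E.
  rewrite -[X in integral _ X _](preimage_setT phi).
  rewrite -(integral_pushforward mphi (f := EFin \o g))//.
  - by apply/measurable_EFinP; case: bg.
  - by apply: bounded_measurable_integrable => //; rewrite preimage_setT.
by apply: eq_measure_integral => A mA _; exact/esym/muphi.
Qed.

Lemma ae_subset_eq_measure (A B : set T) : measurable A -> measurable B ->
  A `<=` B -> mu A = mu B -> {ae mu, forall x, A x <-> B x}.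
Proof.
move=> mA mB AB muAB; exists (B `\` A); split; first exact: measurableD.
  have fB := fin_num_probability mB.
  by rewrite measureD ?ltey_eq ?fB// (setIidr AB)/= muAB subee.
move=> x /= ABx; have [Bx|nBx] := pselect (B x).
  by split=> // Ax; apply: ABx.
by exfalso; apply: ABx; split=> // /AB.
Qed.

Lemma Rintegral_sum n (g : 'I_n -> T -> R) (c : 'I_n -> R) :
  (forall i, bounded_measurable (g i)) ->
  \int[mu]_x (\sum_i c i * g i x) = \sum_i c i * \int[mu]_x g i x.
Proof.
move=> bg; pose f s x := \sum_(i <- s) c i * g i x.
suff /(_ (index_enum _))[] : forall s, bounded_measurable (f s) /\
  \int[mu]_x f s x = \sum_(i <- s) c i * \int[mu]_x g i x by [].
rewrite /f; elim=> [|i s [bs IH]].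
  under eq_fun do rewrite big_nil; rewrite big_nil.
  split; first exact: bounded_measurable_cst.
  by rewrite Rintegral_probability_cst.
under eq_fun do rewrite big_cons.
split; first exact: bounded_measurable_lin.
have bcg := bounded_measurableM (bounded_measurable_cst (c i)) (bg i).
by rewrite big_cons RintegralD ?RintegralZl ?IH//;
  exact: bounded_measurable_integrable.
Qed.

End bounded_measurable.

(** * Affine functions and an almost sure bound on those that are rarely large *)

Section affine_functions.
Variables (R : realType) (V : vectType R) (ip : {dot V for idfun}).
Local Notation E := (inner_space ip).
Implicit Types x y z : E.

(* If [f = phi + c] with [phi] linear, both sides equal
   [a phi x + phi y + c]. *)
Definition affine_fun (f : E -> R) :=
  forall a x y, f (a *: x + y) = a * f x + f y - a * f 0.

Lemma affine_comp f (S : 'End(E)) h :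
  affine_fun f -> affine_fun (fun x => f (S x + h)).
Proof.
move=> af a x y; rewrite linearP linear0 add0r.
(* The sum is regrouped so that the affine identity applies twice, once with [a] and once with
   [- a]. *)
have -> : a *: S x + S y + h = a *: (S x + h) + ((- a) *: h + (S y + h)).
  rewrite scalerDr scaleNr !addrA; congr (_ + h).
  rewrite -!addrA; congr (_ + _).
  by rewrite addrA subrr add0r.
by rewrite !af; lra.
Qed.

Lemma affine_ip z : affine_fun (fun x => ip x z).
Proof.
move=> a x y; have z0 : ip 0 z = 0.
  by have := ip_linear 1 0 0 z; rewrite scaler0 addr0; lra.
by rewrite ip_linear z0; lra.
Qed.

Lemma affine_scale c f : affine_fun f -> affine_fun (fun x => c * f x).
Proof. by move=> af a x y; rewrite af; lra. Qed.

Lemma affine_sum f n (c : 'I_n -> R) (v : 'I_n -> E) : affine_fun f ->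
  f (\sum_i c i *: v i) = f 0 + \sum_i c i * (f (v i) - f 0).
Proof.
move=> af; have : forall s : seq 'I_n,
  f (\sum_(i <- s) c i *: v i) = f 0 + \sum_(i <- s) c i * (f (v i) - f 0).
  by elim=> [|i s IH]; rewrite ?big_nil ?addr0// !big_cons af IH; lra.
exact.
Qed.

Section basis.
Variables (k : nat) (e : 'I_k -> E).
Hypothesis eE : forall x, x = \sum_i ip x (e i) *: e i.

Lemma affine_lipschitz f x y : affine_fun f ->
  `|f x - f y| <= `|x - y| * \sum_i `|f (e i) - f 0|.
Proof.
move=> af; have -> : f x - f y = f (x - y) - f 0.
  by have := af (-1) y x; rewrite scaleN1r [- y + x]addrC; lra.
rewrite [in leLHS](eE (x - y)) (affine_sum _ _ af) addrAC subrr add0r mulr_sumr.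
apply: le_trans (ler_norm_sum _ _ _) _; apply: ler_sum => i _.
by rewrite normrM ler_wpM2r// (ip_le_norm eE).
Qed.
End basis.

Lemma affine_continuous f : affine_fun f -> continuous f.
Proof.
move=> af; have [k [e [_ eE]]] := orthonormal_basis ip.
have fM x y := affine_lipschitz eE x y af.
exact: (@lipschitz_continuous _ _ _ R^o f) fM.
Qed.

Lemma measurable_affine f : affine_fun f -> measurable_fun setT f.
Proof. by move=> /affine_continuous/continuous_measurable_real. Qed.

Lemma norm_continuous_inner : continuous (fun x : E => `|x|).
Proof. exact: norm_continuous. Qed.

Variable mu : probability E R.

Lemma measurable_norm_gt (r : R) : measurable [set x : E | r < `|x|].
Proof.
apply: open_measurable_inner.
rewrite -[X in open X]/((fun x : E => `|x|) @^-1` [set t | r < t]).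
by apply: open_comp => [x _|]; [exact: norm_continuous_inner|exact: open_gt].
Qed.

Lemma norm_affine_continuous f : affine_fun f -> continuous (fun x => `|f x|).
Proof.
move=> af x; apply: (@continuous_comp _ _ _ f Num.norm).
  exact: affine_continuous.
exact: norm_continuous.
Qed.

Lemma measurable_affine_gt f (r : R) : affine_fun f ->
  measurable [set x | r < `|f x|].
Proof.
move=> af; apply: open_measurable_inner.
rewrite -[X in open X]/((fun x : E => `|f x|) @^-1` [set t | r < t]).
by apply: open_comp => [x _|]; [exact: norm_affine_continuous|exact: open_gt].
Qed.

(** The complements of the balls of radius [n] decrease to the empty set, so their measures tend to
    0. *)
Lemma norm_tight (a : R) : 0 < a ->
  exists2 r, 0 < r & (mu [set x | (r < `|x|)%R] < a%:E)%E.
Proof.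
move=> a0; pose F n := [set x : E | n%:R < `|x|].
have F0 : \bigcap_n F n = set0.
  rewrite -subset0 => x /(_ (Num.trunc `|x|).+1 I); rewrite /F/=.
  by rewrite ltNge ltW// truncnS_gt.
have : mu \o F @ \oo --> 0%E.
  rewrite -(measure0 mu) -F0; apply: nonincreasing_cvg_mu => //.
  - by rewrite ltey_eq fin_num_probability//; exact: measurable_norm_gt.
  - by move=> n; exact: measurable_norm_gt.
  - by rewrite F0.
  - move=> m n mn; apply/subsetPset => x; apply: le_lt_trans.
    by rewrite ler_nat.
(* Taking [N.+1] rather than [N] makes the radius positive. *)
move=> /fine_cvgP[_] /cvgrPdist_lt/(_ _ a0)[N _ /(_ N.+1 (leqnSn _))] /=.
rewrite sub0r normrN ger0_norm ?fine_ge0// => h.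
exists N.+1%:R => //; rewrite -[ltLHS]fineK ?lte_fin//.
by apply: fin_num_probability; exact: measurable_norm_gt.
Qed.

(** The point is that one null set serves all [f]: it will be applied to an uncountable family of
    affine functions at once. *)
Lemma affine_ae_bound : exists a M : R, [/\ 0 < a, 0 < M &
  {ae mu, forall x f, affine_fun f -> (mu [set y | (1 < `|f y|)%R] < a%:E)%E ->
    `|f x| <= M * (1 + `|x|)}].
Proof.
have [k [e [_ eE]]] := orthonormal_basis ip.
pose w x : R := (1 + `|x|)^-1.
have w1_gt0 x : 0 < 1 + `|x| by rewrite ltr_pwDl.
have w_gt0 x : 0 < w x by rewrite invr_gt0.
have mw : measurable_fun setT w.
  apply: continuous_measurable_real => x.
  apply: (@continuousV _ E (fun x => 1 + `|x|)); first by rewrite gt_eqF.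
  apply: (@continuousD R R^o E (fun=> 1) (fun x => `|x|)).
    exact: cst_continuous.
  exact: norm_continuous_inner.
have bw : bounded_measurable w.
  split=> //; exists 1 => x.
  by rewrite gtr0_norm// invf_le1// lerDl.
(* The weighted constant 1 and the weighted coordinates: they are bounded and span all products
   [f w] with [f] affine. *)
pose g i x := if unlift ord0 i is Some j then ip x (e j) * w x else w x.
have bg (i : 'I_k.+1) : bounded_measurable (g i).
  rewrite /g; case: unliftP => // j _; split.
    apply: measurable_funM => //; apply: measurable_affine; exact: affine_ip.
  exists 1 => x; rewrite normrM [`|w x|]gtr0_norm// ler_pdivrMr// mul1r.
  by rewrite (le_trans (ip_le_norm eE _ _))// lerDr.
have [K K0 gK] := ae_sqr_le_Rintegral mu bg.
(* With this first constant the term [K Q mu(A)] is at most [Q / 2], so [Q <= 2]; then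
   [(f w)^2 <= 2 K], which gives the second. *)
exists (2 * K)^-1, (Num.sqrt (2 * K)).
have K2_gt0 : 0 < 2 * K by rewrite mulr_gt0.
split; [by rewrite invr_gt0|by rewrite sqrtr_gt0|].
have fw f : affine_fun f -> exists c : 'I_k.+1 -> R,
    forall x, f x * w x = \sum_j c j * g j x.
  move=> af.
  exists (fun i => if unlift ord0 i is Some j then f (e j) - f 0 else f 0).
  move=> x; rewrite big_ord_recl /g unlift_none.
  under eq_bigr do rewrite liftK.
  rewrite [x in f x](eE x) (affine_sum _ _ af) mulrDl mulr_suml; congr (_ + _).
  by apply: eq_bigr => i _; rewrite mulrA [ip _ _ * _]mulrC.
have {}gK : {ae mu, forall x f, affine_fun f ->
    (f x * w x) ^+ 2 <= K * \int[mu]_y (f y * w y) ^+ 2}.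
  apply: filterS gK => x gx f /fw[c fc].
  by under eq_Rintegral do rewrite fc; rewrite fc.
have Q2 f : affine_fun f -> (mu [set y | (1 < `|f y|)%R] < ((2 * K)^-1)%:E)%E ->
    \int[mu]_y (f y * w y) ^+ 2 <= 2.
  move=> af; set A := [set y | _]; set Q := \int[mu]_y _ => muA.
  have mA : measurable A by exact: measurable_affine_gt.
  have bfw : bounded_measurable (fun x => f x * w x).
    have [c /funext->] := fw _ af.
    exact: bounded_measurable_sum.
  have Q_ge0 : 0 <= Q by apply: Rintegral_ge0 => x _; exact: sqr_ge0.
  have b1A := bounded_measurable_lin (K * Q) (bounded_measurable_indic R mA)
    (bounded_measurable_cst E 1).
  (* On [A] the square is at most [K Q] almost everywhere; off [A] both [|f|] and [w] are at most
     1. *)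
  have Q1 : Q <= \int[mu]_x (K * Q * \1_A x + 1).
    apply: ae_le_Rintegral => //.
      have := bounded_measurableM bfw bfw; congr bounded_measurable.
    apply: filterS gK => x /(_ _ af) Kx; rewrite indicE.
    have [xA|xA] := boolP (x \in A).
      by rewrite mulr1 (le_trans Kx)// lerDl.
    rewrite mulr0 add0r -[leRHS](expr1n _ 2) -real_normK ?num_real//.
    rewrite ler_pXn2r ?nnegrE//.
    rewrite normrM [`|w x|]gtr0_norm// ler_pdivrMr// mul1r.
    move/negP: xA; rewrite in_setE /A/= => /negP; rewrite -leNgt.
    by move=> /le_trans->//; rewrite lerDl.
  have : Q <= K * Q * fine (mu A) + 1.
    apply: le_trans Q1 _; rewrite RintegralD//.
    - rewrite RintegralZl//; last first.
        exact/bounded_measurable_integrable/bounded_measurable_indic.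
      by rewrite Rintegral_indic// Rintegral_probability_cst.
    - apply: bounded_measurable_integrable => //.
      apply: bounded_measurableM (bounded_measurable_cst E _) _.
      exact: bounded_measurable_indic.
    - exact/bounded_measurable_integrable/bounded_measurable_cst.
  have muA' : fine (mu A) <= (2 * K)^-1.
    by rewrite -lee_fin fineK ?ltW// fin_num_probability.
  have : K * Q * fine (mu A) <= Q / 2.
    rewrite (le_trans (ler_wpM2l _ muA')) ?mulr_ge0 ?(ltW K0)//.
    by rewrite invfM [2^-1 * _]mulrC mulrACA divff ?mul1r ?gt_eqF// mulrC.
  by lra.
apply: filterS gK => x fx f af /(Q2 _ af) Q.
have {}fx := le_trans (fx f af) (ler_wpM2l (ltW K0) Q).
rewrite -ler_pdivrMr// -/(w x) -[w x]gtr0_norm// -normrM -sqrtr_sqr.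
by rewrite ler_wsqrtr// [2 * K]mulrC.
Qed.

End affine_functions.

(** * The barycenter fixed by all symmetries *)

Section symmetric_barycenter.
Variables (R : realType) (V : vectType R) (ip : {dot V for idfun}).
Local Notation E := (inner_space ip).
Variable mu : probability E R.

(** The product measure integrates the [\d_h]-mass of the sections, and the section at [x] has mass
    1 or 0 according to whether [x + h] is in [A]. *)
Lemma convolution_dirac (nu : {measure set E -> \bar R}) (h : E) A :
  measurable A -> convolution nu (\d_h) A = nu [set x | A (x + h)].
Proof.
move=> mA; have mAh := measurable_translate h mA.
rewrite /convolution /pushforward /product_measure1.
rewrite -[X in _ = nu X]setIT -integral_indic//; apply: eq_integral => x _ /=.
by rewrite diracE indicE mem_xsection.
Qed.

Lemma symmetries_invariant S : symmetries mu S -> exists h : E,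
  forall A, measurable A -> mu A = mu [set x | A (S x + h)].
Proof.
move=> [h Sh]; exists h => A mA; rewrite Sh//.
(* Packing [S] as a measurable function makes the image of [mu] a genuine measure, as
   [convolution_dirac] requires. *)
pose mS_mixin := isMeasurableFun.Build _ _ _ _ _ (measurable_End S).
pose S' : {mfun E >-> E} := HB.pack (S : E -> E) mS_mixin.
exact: (@convolution_dirac (pushforward mu S') h A mA).
Qed.

Lemma common_fixed_point : exists b : E, forall (S : 'End(E)) (h : E),
  (forall A, measurable A -> mu A = mu [set x | A (S x + h)]) -> S b + h = b.
Proof.
have [k [e [ee eE]]] := orthonormal_basis ip.
have [a [M [a0 M0 aM]]] := affine_ae_bound mu.
(* The ball of radius [r] has positive mass and will show that [B] has too; [r'] will serve to bound
   [B]. *)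
have [r r0 mur] := norm_tight mu ltr01.
have [r' r'0 mur'] := norm_tight mu a0.
pose F := [set f : E -> R |
  affine_fun f /\ (mu [set y | (1 < `|f y|)%R] < a%:E)%E].
pose C := M * (1 + r).
pose B := \bigcap_(f in F) [set x | `|f x| <= C].
have mB : measurable B.
  apply: closed_measurable_inner; apply: closed_bigI => f [af _].
  rewrite -[X in closed X]/((fun x : E => `|f x|) @^-1` [set t | t <= C]).
  apply: preimage_closed => [x _|]; last exact: closed_le.
  exact: norm_affine_continuous.
(* By the choice of [C], the ball of radius [r] lies in [B] up to a null set [N]. Were [B] null, the
   complement of the ball would have mass 1. *)
have muB_gt0 : (0 < mu B)%E.
  have [N [mN N0 BN]] := aM.
  rewrite lt0e measure_ge0 andbT; apply/eqP => B0.
  have mN' : measurable (B `|` N) by exact: measurableU.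
  have mr := @measurable_norm_gt R V ip r.
  have : (mu setT <= mu (B `|` N `|` [set x | (r < `|x|)%R]))%E.
    rewrite le_measure ?inE//; first exact: measurableU.
    move=> x _; have [xr|xr] := ltP r `|x|; first by right.
    left; have [Nx|Nx] := pselect (N x); [by right|left] => f [af fa] /=.
    have /contrapT xM := contra_not (BN x) Nx.
    rewrite (le_trans (xM f af fa))// /C ler_wpM2l ?(ltW M0)// lerD2l//.
  apply/negP; rewrite -ltNge probability_setT.
  apply: le_lt_trans (measureU2 _ mN' mr) _.
  apply: le_lt_trans mur; rewrite -[leRHS]add0e leeD2r//.
  by rewrite (le_trans (measureU2 _ _ _))//= B0 N0 adde0.
pose m := fine (mu B); have m_gt0 : 0 < m.
  by rewrite fine_gt0// muB_gt0 ltey_eq fin_num_probability.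
(* A coordinate divided by [r'] exceeds 1 in absolute value only outside the ball of radius [r'], so
   it belongs to [F] and is at most [C] on [B]. *)
have boundedB i : exists K, forall x, B x -> `|ip x (e i)| <= K.
  exists (r' * C) => x; pose f y := r'^-1 * ip y (e i).
  have /[swap] /[apply] : F f.
    split; first exact/affine_scale/affine_ip.
    apply: le_lt_trans mur'; apply: le_measure; rewrite ?inE.
    - by apply: measurable_affine_gt; exact/affine_scale/affine_ip.
    - exact: measurable_norm_gt.
    move=> y /=; rewrite /f normrM gtr0_norm ?invr_gt0// mulrC.
    rewrite ltr_pdivlMr// mul1r.
    by move=> /lt_le_trans; apply; exact: ip_le_norm eE _ _.
  rewrite /= /f normrM gtr0_norm ?invr_gt0// mulrC ler_pdivrMr//.
  by rewrite [C * _]mulrC.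
have b1B : bounded_measurable (\1_B : E -> R).
  exact: bounded_measurable_indic.
pose c i x := \1_B x * ip x (e i).
have bc i : bounded_measurable (c i).
  split.
    apply: measurable_funM; first by case: b1B.
    by apply: measurable_affine; exact: affine_ip.
  have [K xK] := boundedB i; exists `|K| => x; rewrite /c indicE.
  have [|_] := boolP (x \in B); last by rewrite mul0r normr0.
  by move=> /set_mem/xK xK'; rewrite mul1r (le_trans xK')// ler_norm.
have affB f : affine_fun f -> forall x, \1_B x * f x =
    f 0 * \1_B x + \sum_i (f (e i) - f 0) * c i x.
  move=> af x; rewrite [x in f x]eE (affine_sum _ _ af) mulrDr mulrC mulr_sumr.
  by congr (_ + _); apply: eq_bigr => i _; rewrite /c mulrA mulrC.
have bB f : affine_fun f -> bounded_measurable (fun x => \1_B x * f x).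
  move=> af; rewrite (funext (affB _ af)).
  exact/(bounded_measurable_lin _ b1B)/bounded_measurable_sum.
(* The barycenter of [mu] restricted to [B] and normalized, computed by coordinates. *)
pose b := \sum_i (m^-1 * \int[mu]_x c i x) *: e i.
have bary f : affine_fun f -> \int[mu]_x (\1_B x * f x) = m * f b.
  move=> af; rewrite (funext (affB _ af)) RintegralD//.
  - rewrite RintegralZl//; last exact: bounded_measurable_integrable.
    rewrite Rintegral_indic// Rintegral_sum// (affine_sum _ _ af) mulrDr mulrC.
    rewrite mulr_sumr; congr (_ + _); apply: eq_bigr => i _.
    by rewrite !mulrA divff ?gt_eqF// mul1r mulrC.
  - apply: bounded_measurable_integrable => //.
    exact: bounded_measurableM (bounded_measurable_cst E _) b1B.
  - exact/bounded_measurable_integrable/bounded_measurable_sum.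
exists b => S h Sh; pose T x := S x + h.
(* As [T] preserves [mu], the family [F] is stable under composition with [T]. *)
have BT : B `<=` T @^-1` B.
  move=> x Bx f [af fa]; apply: (Bx (f \o T)); split; first exact: affine_comp.
  rewrite -[X in (mu X < _)%E]/(T @^-1` [set y | 1 < `|f y|]) -Sh//.
  exact: measurable_affine_gt.
have mT : measurable_fun setT T by exact: measurable_End_affine.
have mTB : measurable (T @^-1` B).
  by rewrite -[X in measurable X]setTI; exact: mT.
(* Both sides, times [m], are integrals over [B], of [f \o T] and of [f]. By invariance the latter
   is the integral of [f \o T] over the preimage of [B], which equals [B] up to a null set. *)
have fT f : affine_fun f -> f (T b) = f b.
  move=> af; have afT : affine_fun (f \o T) by exact: affine_comp.
  apply: (mulfI (lt0r_neq0 m_gt0)); rewrite -(bary _ af) -(bary _ afT).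
  rewrite -[RHS](Rintegral_invariant mT Sh (bB _ af)).
  apply: ae_eq_Rintegral; [exact: bB|exact: bounded_measurable_comp (bB _ af)|].
  have := ae_subset_eq_measure mB mTB BT (Sh _ mB); apply: filterS => x BTx.
  rewrite /= !indicE; congr (_%:R * _); congr nat_of_bool.
  by apply/idP/idP => /set_mem/BTx/mem_set.
rewrite -/(T b) [LHS]eE [RHS]eE; apply: eq_bigr => i _.
by rewrite (fT _ (affine_ip _)).
Qed.

End symmetric_barycenter.

Theorem theorem4 (R : realType) (V : vectType R) (ip : {dot V for idfun})
    (mu : probability (inner_space ip) R) :
  exists h' : inner_space ip,
    forall S : 'End(inner_space ip), symmetries mu S ->
      measure_eq (convolution mu (\d_h'))
                 (image_measure S (convolution mu (\d_h'))).
Proof.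
have [b fixb] := common_fixed_point mu; exists (- b) => S.
move=> /symmetries_invariant[h Sh] A mA.
have mSA : measurable (S @^-1` A).
  by rewrite -[X in measurable X]setTI; exact: measurable_End.
have mAb := measurable_translate (- b) mA.
rewrite convolution_dirac// /image_measure /pushforward convolution_dirac//.
rewrite /= Sh//; congr (mu _); apply/funext => x /=; congr A.
(* Since [S b + h = b], the point [S x + h - b] is [S (x - b)]. *)
by rewrite linearB -[in LHS](fixb S h Sh) opprD addrACA subrr addr0.
Qed.
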